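(* The deterministic greedy algorithm, which assigns each arriving item $i$ to a bidder $j$ maximizing the marginal value $f_j(S_j\cup\{i\})-f_j(S_j)$ (where $S_j$ is the set of items assigned to bidder $j$ so far) if this maximum marginal value is non-negative and discards $i$ otherwise, achieves a competitive ratio of approximately $0.27493$ (namely $\frac{1}{\sqrt5}\big(e^{-ax^*}-e^{-bx^*}\big)$ with $a=\frac{3-\sqrt5}{2}$, $b=\frac{3+\sqrt5}{2}$, $x^*=\frac{\ln(b/a)}{\sqrt5}$) for online Submodular Welfare in the random order setting with general (not necessarily monotone) non-negative submodular utilities; i.e., for every instance, the expected value (over the uniformly random arrival order) of the greedy allocation is at least this constant times the optimal offline value.
   Context: A set function $f:2^{\mathcal N}\to\mathbb R_{\ge 0}$ is submodular if $f(A\cup B)+f(A\cap B)\le f(A)+f(B)$ for all $A,B\subseteq\mathcal N$. Online Submodular Welfare: there are $n$ bidders, bidder $j$ having a non-negative submodular (not necessarily monotone) utility $f_j$ over a set $\mathcal N$ of $m$ items that arrive one by one. When an item arrives, the algorithm must immediately and irrevocably assign it to one bidder or discard it; the goal is to maximize $\sum_j f_j(S_j)$ where the sets $S_j$ of items assigned to the bidders are pairwise disjoint. The optimal offline value is $\max\{\sum_j f_j(O_j): O_1,\dots,O_n\subseteq\mathcal N\text{ pairwise disjoint}\}$. In the random order setting the items arrive in a uniformly random order. *)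

(* Defs.v *)
From HB Require Import structures.
From mathcomp Require Import all_boot all_order all_algebra all_fingroup.
From mathcomp Require Import all_classical all_reals all_analysis.
Set Implicit Arguments. Unset Strict Implicit. Unset Printing Implicit Defensive.
Import Order.TTheory GRing.Theory Num.Theory.
Local Open Scope ring_scope.

Section OSW.
Variable R : realType.

Definition submodular (m : nat) (g : {set 'I_m} -> R) : Prop :=
  forall A B : {set 'I_m}, g (A :|: B) + g (A :&: B) <= g A + g B.
Definition nonneg_fun (m : nat) (g : {set 'I_m} -> R) : Prop :=
  forall A : {set 'I_m}, 0 <= g A.

(* an allocation state: the set of items assigned so far to each bidder *)
Definition alloc (n m : nat) := {ffun 'I_n -> {set 'I_m}}.

Definition marginal n m (f : 'I_n -> {set 'I_m} -> R) (S : alloc n m)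
    (j : 'I_n) (i : 'I_m) : R :=
  f j (i |: S j) - f j (S j).

Definition greedy_choice n m (f : 'I_n -> {set 'I_m} -> R) (S : alloc n m)
    (i : 'I_m) (o : option 'I_n) : Prop :=
  match o with
  | Some j => 0 <= marginal f S j i /\ forall k, marginal f S k i <= marginal f S j i
  | None => forall k, marginal f S k i < 0
  end.

Definition assign n m (S : alloc n m) (o : option 'I_n) (i : 'I_m) : alloc n m :=
  match o with
  | Some j => [ffun k => if k == j then i |: S k else S k]
  | None => S
  end.

(* run a (tie-breaking) selection rule on an arrival sequence;
   the rule may see the prefix of items arrived so far, the state and the item *)
Fixpoint run n m (sel : seq 'I_m -> alloc n m -> 'I_m -> option 'I_n)
    (pre : seq 'I_m) (S : alloc n m) (l : seq 'I_m) : alloc n m :=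
  match l with
  | [::] => S
  | i :: l' => run sel (rcons pre i) (assign S (sel pre S i) i) l'
  end.

Definition empty_alloc n m : alloc n m := [ffun=> (finset.set0 : {set 'I_m})].

Definition welfare n m (f : 'I_n -> {set 'I_m} -> R) (S : alloc n m) : R :=
  \sum_(j < n) f j (S j).

Definition greedy_outcome n m (sel : seq 'I_m -> alloc n m -> 'I_m -> option 'I_n)
    (s : {perm 'I_m}) : alloc n m :=
  run sel [::] (empty_alloc n m) [seq s k | k <- enum 'I_m].

Definition expected_greedy n m (f : 'I_n -> {set 'I_m} -> R)
    (sel : seq 'I_m -> alloc n m -> 'I_m -> option 'I_n) : R :=
  (m`!)%:R^-1 * \sum_(s : {perm 'I_m}) welfare f (greedy_outcome sel s).

Definition pairwise_disjoint n m (O : alloc n m) : Prop :=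
  forall j k : 'I_n, j != k -> [disjoint O j & O k].

Definition ca : R := (3 - Num.sqrt 5) / 2.
Definition cb : R := (3 + Num.sqrt 5) / 2.
Definition xstar : R := ln (cb / ca) / Num.sqrt 5.
Definition greedy_ratio : R :=
  (expR (- (ca * xstar)) - expR (- (cb * xstar))) / Num.sqrt 5.

End OSW.

(* Main.v *)
(** Let [S] be the greedy allocation after the items of [A] have arrived,
    [W = sum_j f_j(S_j)] and [P = sum_j f_j(S_j u (O_j \ A))].  Summing over the
    items [u] outside [A], the greedy gains add up to at least [P - W], and the
    changes of [W + P] add up to at least [- P]: taking [u] away from its owner
    in [O] costs no more than its marginal at [S], hence than the greedy gain,
    while giving items to bidder [j] on top of [S_j u (O_j \ A)] costs at most
    [f_j(S_j u (O_j \ A))] in total, by submodularity and nonnegativity.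

    If items arrive at independent exponential times, the order is uniform and
    each remaining item arrives at rate one, so the means [G] of [W] and [H] of
    [W + P] satisfy [G' >= H - 2 G] and [H' >= G - H] exactly, without
    discretization error.  Pairing with the nonnegative solution of the dual
    linear system, whose eigenvalues are [ca] and [cb], bounds [G] at time
    [xstar] from below, and the greedy value never decreases afterwards. *)

Require Import Defs.
From HB Require Import structures.
From mathcomp Require Import all_boot all_order all_algebra all_fingroup.
From mathcomp Require Import all_classical all_reals all_analysis.
From mathcomp Require Import ring lra.
Import Order.TTheory GRing.Theory Num.Theory.
Import numFieldNormedType.Exports.
Local Open Scope ring_scope.

(** * Averages over the number of items arrived by a given time *)

Section BinomialAverage.
Variables (R : realType) (m : nat).

(* Probability that exactly [i] of [m] items with independent rate-one
   exponential arrival times have arrived by time [x]. *)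
Definition arrival_prob (i : nat) (x : R) : R :=
  'C(m, i)%:R * ((1 - expR (- x)) ^+ i * expR (- x) ^+ (m - i)).

Definition arrival_mean (g : nat -> R) (x : R) : R :=
  \sum_(i < m.+1) arrival_prob i x * g i.

(** Rate of change of [g] when each of the [m - i] remaining items arrives at rate one. *)
Definition drift (g : nat -> R) (i : nat) : R := (m - i)%:R * (g i.+1 - g i).

Lemma is_derive_expRN (c x : R) :
  is_derive x 1 (fun y => expR (- (c * y))) (- c * expR (- (c * x))).
Proof.
have h : is_derive x 1 (fun y : R => - (c * y)) (- c).
  rewrite (_ : (fun y : R => _) = (- c) \*: (id : R -> R)); last first.
    by apply/funext => y /=; rewrite /GRing.scale /= mulNr.
  by apply: is_derive_eq; rewrite /GRing.scale /= mulr1.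
by apply: is_derive_eq (is_derive1_comp _ h) _; rewrite mulrC.
Qed.

(** Forward Kolmogorov equation of the pure birth process with rate [m - i] in state [i]. *)
Lemma is_derive_arrival_prob (i : nat) (x : R) : (i <= m)%N ->
  is_derive x 1 (arrival_prob i)
    ((if i is k.+1 then (m - k)%:R * arrival_prob k x else 0)
     - (m - i)%:R * arrival_prob i x).
Proof.
move=> im; set E : R -> R := fun y => expR (- y).
have dE : is_derive x 1 E (- E x).
  rewrite (_ : E = fun y => expR (- (1 * y))).
    by apply: is_derive_eq (is_derive_expRN 1 x) _; rewrite mulN1r mul1r.
  by apply/funext => y; rewrite mul1r.
have dE1 : is_derive x 1 (cst 1 - E) (E x).
  by apply: is_derive_eq; rewrite sub0r opprK.
rewrite [X in is_derive _ _ X _](_ : _ =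
  'C(m, i)%:R \*: ((cst 1 - E) ^+ i * E ^+ (m - i))); last first.
  by apply/funext => y; rewrite /arrival_prob !fctE.
apply: is_derive_eq.
rewrite /GRing.scale /= /arrival_prob !fctE -/(E x).
(* At [k = 0] the truncated predecessor is harmless: the factor [k] kills both sides. *)
have predE k : k%:R * E x ^+ k.-1 * E x = k%:R * E x ^+ k.
  by case: k => [|k]; rewrite ?mul0r //= exprSr mulrA.
rewrite mulrN predE.
case: i im => [|k] km /=; first by rewrite !mul0r mulr0 addr0 sub0r; ring.
have -> : (m - k = (m - k.+1).+1)%N by rewrite subnSK.
have /(congr1 (fun n => n%:R : R)) := mul_bin_left m k.
rewrite -(subnSK km) !natrM => hb.
transitivity (k.+1%:R * 'C(m, k.+1)%:R * ((1 - E x) ^+ k * E x ^+ (m - k.+1) * E x)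
  - (m - k.+1)%:R * ('C(m, k.+1)%:R * ((1 - E x) ^+ k.+1 * E x ^+ (m - k.+1)))).
  by ring.
by rewrite hb [E x ^+ (m - k.+1).+1]exprSr; congr (_ - _); ring.
Qed.

Lemma is_derive_arrival_mean (g : nat -> R) (x : R) :
  is_derive x 1 (arrival_mean g) (arrival_mean (drift g) x).
Proof.
pose h (i : 'I_m.+1) : R -> R := g i \*: arrival_prob i.
rewrite (_ : arrival_mean g = \sum_i h i); last first.
  apply/funext => y; rewrite fct_sumE; apply: eq_bigr => i _.
  by rewrite /h /= /GRing.scale /= mulrC.
have dh (i : 'I_m.+1) := is_derive_arrival_prob i x (ltn_ord i).
apply: is_derive_eq.
rewrite /GRing.scale /=.
under eq_bigr do rewrite mulrBr.
rewrite big_split /= sumrN big_ord_recl /= mulr0 add0r.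
rewrite [in X in X - _ = _](eq_bigr (fun i : 'I_m => g i.+1 * ((m - i)%:R * arrival_prob i x))) //.
rewrite /arrival_mean /drift.
(* The terms of index [m] carry the factor [m - m], so [g m.+1] has no influence. *)
rewrite [X in _ - X = _]big_ord_recr [RHS]big_ord_recr /= subnn !mul0r !mulr0 !addr0.
rewrite -sumrB; apply: eq_bigr => i _ /=; ring.
Qed.

Lemma arrival_prob_ge0 (i : nat) (x : R) : 0 <= x -> 0 <= arrival_prob i x.
Proof.
move=> x0; rewrite /arrival_prob !mulr_ge0 ?exprn_ge0 ?expR_ge0 //.
by rewrite subr_ge0 expR_le1 oppr_le0.
Qed.

Lemma sum_arrival_prob (x : R) : \sum_(i < m.+1) arrival_prob i x = 1.
Proof.
have := exprDn (expR (- x)) (1 - expR (- x)) m.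
rewrite addrC subrK expr1n => ->; apply: eq_bigr => i _.
by rewrite /arrival_prob mulr_natl [_ ^+ _ * _]mulrC.
Qed.

Lemma arrival_mean0 (g : nat -> R) : arrival_mean g 0 = g 0%N.
Proof.
rewrite /arrival_mean big_ord_recl big1 ?addr0 => [|i _].
  by rewrite /arrival_prob /= bin0 expr0 oppr0 expR0 expr1n !mul1r.
by rewrite /arrival_prob /= oppr0 expR0 subrr expr0n /= mul0r mulr0 mul0r.
Qed.

Lemma ler_arrival_mean (g h : nat -> R) (x : R) : 0 <= x ->
  (forall i, (i <= m)%N -> g i <= h i) -> arrival_mean g x <= arrival_mean h x.
Proof.
move=> x0 gh; apply: ler_sum => i _.
by apply: ler_wpM2l; [exact: arrival_prob_ge0 | apply: gh; rewrite -ltnS].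
Qed.

Lemma arrival_mean_le (g : nat -> R) (c x : R) : 0 <= x ->
  (forall i, (i <= m)%N -> g i <= c) -> arrival_mean g x <= c.
Proof.
move=> x0 gc; apply: le_trans (ler_arrival_mean _ (fun=> c) x x0 gc) _.
by rewrite /arrival_mean -mulr_suml sum_arrival_prob mul1r.
Qed.

Lemma arrival_meanB (g h : nat -> R) (x : R) :
  arrival_mean (fun i => g i - h i) x = arrival_mean g x - arrival_mean h x.
Proof. by rewrite /arrival_mean -sumrB; apply: eq_bigr => i _; rewrite mulrBr. Qed.

End BinomialAverage.

(** * The differential inequalities and their dual weights *)

Section GreedyRecurrence.
Variable R : realType.
Local Notation a := (ca R).
Local Notation b := (cb R).
Local Notation r5 := (Num.sqrt (5 : R)).

(** The two weights solve the dual system with values 0 and 1 at time 0. The ratio is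
    [residual_weight] at [xstar], its maximizer. *)
Definition residual_weight (s : R) : R :=
  (expR (- (a * s)) - expR (- (b * s))) / r5.
Definition value_weight (s : R) : R :=
  ((1 - a) * expR (- (a * s)) - (1 - b) * expR (- (b * s))) / r5.

Lemma sqrt5_sqr : r5 ^+ 2 = 5.
Proof. by rewrite sqr_sqrtr. Qed.

Lemma sqrt5_gt : 2 < r5.
Proof. by rewrite -(ltr_pXn2r (n := 2)) ?nnegrE ?sqrtr_ge0 // sqrt5_sqr; lra. Qed.

Lemma sqrt5_lt : r5 < 3.
Proof. by rewrite -(ltr_pXn2r (n := 2)) ?nnegrE ?sqrtr_ge0 // sqrt5_sqr; lra. Qed.

Lemma ca_gt0 : 0 < a.
Proof. by have := sqrt5_lt; rewrite /ca; lra. Qed.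

Lemma ca_lt_cb : a < b.
Proof. by have := sqrt5_gt; rewrite /ca /cb; lra. Qed.

Lemma xstar_ge0 : 0 <= xstar R.
Proof.
rewrite /xstar divr_ge0 ?sqrtr_ge0 // ln_ge0 // ler_pdivlMr ?ca_gt0 // mul1r.
exact/ltW/ca_lt_cb.
Qed.

Lemma residual_weight_ge0 (s : R) : 0 <= s -> 0 <= residual_weight s.
Proof.
move=> s0; rewrite divr_ge0 ?sqrtr_ge0 // subr_ge0 ler_expR lerN2.
by apply: ler_wpM2r => //; exact/ltW/ca_lt_cb.
Qed.

(** Both terms are nonnegative, since [a < 1 < b]. *)
Lemma value_weight_ge0 (s : R) : 0 <= value_weight s.
Proof.
have h := sqrt5_gt; rewrite divr_ge0 ?sqrtr_ge0 //.
have ea := expR_ge0 (- (a * s)); have eb := expR_ge0 (- (b * s)).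
by rewrite addr_ge0 // -?mulNr mulr_ge0 // /ca /cb; lra.
Qed.

(* [a] and [b] are the roots of [z^2 - 3 z + 1], so these are the dual
   equations of [G' = H - 2 G], [H' = G - H]. *)
Lemma is_derive_residual_weight (s : R) :
  is_derive s 1 residual_weight (value_weight s - residual_weight s).
Proof.
have da := is_derive_expRN R a s; have db := is_derive_expRN R b s.
rewrite [X in is_derive _ _ X _](_ : _ = r5^-1 \*:
  ((fun y => expR (- (a * y))) - (fun y => expR (- (b * y))))); last first.
  by apply/funext => y; rewrite /residual_weight !fctE /= /GRing.scale /= mulrC.
apply: is_derive_eq; rewrite /GRing.scale /= /value_weight /residual_weight; ring.
Qed.

Lemma is_derive_value_weight (s : R) :
  is_derive s 1 value_weight (residual_weight s - 2 * value_weight s).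
Proof.
have da := is_derive_expRN R a s; have db := is_derive_expRN R b s.
rewrite [X in is_derive _ _ X _](_ : _ = r5^-1 \*:
  (((1 - a) \*: (fun y => expR (- (a * y)))) -
   ((1 - b) \*: (fun y => expR (- (b * y)))))); last first.
  by apply/funext => y; rewrite /value_weight !fctE /= /GRing.scale /= mulrC.
apply: is_derive_eq; rewrite /GRing.scale /= /value_weight /residual_weight.
have ha : a * a = 3 * a - 1 by have := sqrt5_sqr; rewrite /ca; nra.
have hb : b * b = 3 * b - 1 by have := sqrt5_sqr; rewrite /cb; nra.
have -> : (1 - a) * (- a * expR (- (a * s))) = (2 * a - 1) * expR (- (a * s)).
  by rewrite mulrA; congr (_ * _); rewrite mulrBl mul1r mulrN opprK ha; ring.
have -> : (1 - b) * (- b * expR (- (b * s))) = (2 * b - 1) * expR (- (b * s)).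
  by rewrite mulrA; congr (_ * _); rewrite mulrBl mul1r mulrN opprK hb; ring.
by ring.
Qed.

Lemma value_weight0 : value_weight 0 = 1.
Proof.
have h := sqrt5_gt; rewrite /value_weight !mulr0 oppr0 expR0 !mulr1.
by rewrite (_ : _ - _ = r5) ?divff // /ca /cb; lra.
Qed.

Lemma residual_weight0 : residual_weight 0 = 0.
Proof. by rewrite /residual_weight !mulr0 subrr mul0r. Qed.

Lemma is_derive_reflect (f : R -> R) (df c x : R) :
  is_derive (c - x) 1 f df -> is_derive x 1 (fun y => f (c - y)) (- df).
Proof.
move=> hf; have hc : is_derive x 1 (fun y => c - y : R) (-1).
  rewrite (_ : (fun y => _) = cst c - (id : R -> R)) //.
  by apply: is_derive_eq; rewrite sub0r.
have := @is_derive1_comp R f (fun y => c - y) x df (-1) hf hc.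
by rewrite mulrN1.
Qed.

(** The weights run backwards from [xstar], so that in the derivative of the pairing [H] their own
    derivatives cancel the lower bounds on the drifts and [H] is nondecreasing. At time [xstar] it
    is the mean of [g]; at time 0 it is at least the ratio times [p 0]. *)
Lemma greedy_recurrence (m : nat) (g p : nat -> R) :
  0 <= g 0%N ->
  (forall i, (i <= m)%N -> g i <= g m) ->
  (forall i, (i <= m)%N -> p i - g i <= drift R m g i) ->
  (forall i, (i <= m)%N -> - p i <= drift R m (fun k => g k + p k) i) ->
  greedy_ratio R * p 0%N <= g m.
Proof.
move=> g0 gm dg dh; set h := (fun k => g k + p k) in dh.
pose L := arrival_mean R m; pose X := xstar R.
have X0 : 0 <= X := xstar_ge0.
pose H : R -> R := (fun x => value_weight (X - x)) * L g +
                   (fun x => residual_weight (X - x)) * L h.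
(* The sigma type lets the derivative be inferred by unification and keeps its sign with it. *)
have dH (x : R) : {H' : R | is_derive x 1 H H' & (0 <= x <= X -> 0 <= H')}.
  have d1 := is_derive_reflect _ _ X x (is_derive_value_weight (X - x)).
  have d2 := is_derive_reflect _ _ X x (is_derive_residual_weight (X - x)).
  have d3 := is_derive_arrival_mean R m g x.
  have d4 := is_derive_arrival_mean R m h x.
  eexists; first by rewrite /H /L; apply: is_deriveD.
  move=> /andP[x0 xX]; rewrite /GRing.scale /= -/(L g) -/(L h).
  have v0 := value_weight_ge0 (X - x).
  have r0 : 0 <= residual_weight (X - x) by apply: residual_weight_ge0; rewrite subr_ge0.
  have e1 : L h x - L g x - L g x <= L (drift R m g) x.
    rewrite -!arrival_meanB; apply: ler_arrival_mean => // i im.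
    by apply: le_trans (dg i im); rewrite /h; lra.
  have e2 : L g x - L h x <= L (drift R m h) x.
    rewrite -arrival_meanB; apply: ler_arrival_mean => // i im.
    by apply: le_trans (dh i im); rewrite /h; lra.
  have := ler_wpM2l v0 e1; have := ler_wpM2l r0 e2; rewrite /L; nra.
have dHx (x : R) : is_derive x 1 H (s2val (dH x)) by exact: s2valP.
have cH : {within `[0, X], continuous H}%classic.
  apply: derivable_within_continuous => x _; exact: (@ex_derive _ _ _ _ _ _ _ (dHx x)).
have [c cX] := MVT_segment X0 (fun x _ => dHx x) cH.
move: cX; rewrite in_itv /= => cX.
have Hc : 0 <= s2val (dH c) := s2valP' (dH c) cX.
rewrite subr0 => HX.
have {HX Hc} : H 0 <= H X by rewrite -subr_ge0 HX mulr_ge0.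
rewrite /H /= !fctE subrr subr0 value_weight0 residual_weight0 mul1r mul0r addr0.
rewrite /L !arrival_mean0 => HX.
apply: le_trans (arrival_mean_le _ _ _ _ _ X0 gm).
apply: le_trans HX; rewrite /h.
have v0 := value_weight_ge0 X; have r0 := residual_weight_ge0 X X0.
rewrite -[greedy_ratio R]/(residual_weight X) mulrDr addrA lerDr.
by rewrite addr_ge0 // mulr_ge0.
Qed.

End GreedyRecurrence.

(** * Two forms of diminishing returns *)

Section Submodular.
Variables (R : realType) (m : nat) (h : {set 'I_m} -> R).
Hypothesis h_sub : submodular h.

(** Elements of [U] are split off one at a time; those already in [X] have marginal zero. *)
Lemma submodular_le_sum_marginals (X U : {set 'I_m}) :
  h (X :|: U) - h X <= \sum_(u in U) (h (u |: X) - h X).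
Proof.
elim: {U}#|U| {-2}U (erefl #|U|) => [|k IH] U cU.
  by rewrite (cards0_eq cU) finset.setU0 subrr big_set0.
have /card_gt0P[x xU] : (0 < #|U|)%N by rewrite cU.
have cU' : #|U :\ x| = k by move: cU; rewrite (cardsD1 x) xU => -[].
rewrite (big_setD1 x xU) /=.
have := IH _ cU'; have := h_sub (X :|: U :\ x) (x |: X).
have -> : (X :|: U :\ x) :|: (x |: X) = X :|: U.
  by apply/setP => y; rewrite !inE; case: eqP => [->|_]; case: (_ \in X); rewrite /= ?xU ?orbF ?orbT.
have -> : (X :|: U :\ x) :&: (x |: X) = X.
  by apply/setP => y; rewrite !inE; case: eqP => [->|_]; case: (_ \in X); rewrite /= ?andbF.
lra.
Qed.

Lemma submodular_removal (S T : {set 'I_m}) (u : 'I_m) : u \in T ->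
  h (S :|: T) - h (S :|: T :\ u) <= h (u |: S) - h S.
Proof.
move=> uT; have := h_sub (S :|: T :\ u) (u |: S).
have -> : (S :|: T :\ u) :|: (u |: S) = S :|: T.
  by apply/setP => y; rewrite !inE; case: eqP => [->|_]; case: (_ \in S); rewrite /= ?uT ?orbF ?orbT.
have -> : (S :|: T :\ u) :&: (u |: S) = S.
  by apply/setP => y; rewrite !inE; case: eqP => [->|_]; case: (_ \in S); rewrite /= ?andbF.
lra.
Qed.

End Submodular.

(** * Effect of one greedy step from a fixed state *)

Section GreedyStep.
Variables (R : realType) (n m : nat) (f : 'I_n -> {set 'I_m} -> R).
Variables (O : alloc n m).

(* Value when every bidder also receives those items of her part of [O] that
   are outside [A]. *)
Definition residual_welfare (S : alloc n m) (A : {set 'I_m}) : R :=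
  \sum_(j < n) f j (S j :|: (O j :\: A)).

Definition gain (S : alloc n m) (o : option 'I_n) (u : 'I_m) : R :=
  welfare f (assign S o u) - welfare f S.

Lemma gainE (S : alloc n m) (o : option 'I_n) (u : 'I_m) :
  gain S o u = if o is Some j then marginal f S j u else 0.
Proof.
case: o => [j|]; rewrite /gain /=; last by rewrite subrr.
rewrite /welfare (bigD1 j) //= [X in _ - X](bigD1 j) //= ffunE eqxx.
rewrite (eq_bigr (fun k => f k (S k))) => [|k kj].
  by rewrite /marginal opprD addrACA subrr addr0.
by rewrite ffunE (negPf kj).
Qed.

Lemma gain_ge0 (S : alloc n m) (o : option 'I_n) (u : 'I_m) :
  greedy_choice f S u o -> 0 <= gain S o u.
Proof. by rewrite gainE; case: o => [j []|]. Qed.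

(** On a discard the gain is zero and every marginal is negative, so the bound persists. *)
Lemma marginal_le_gain (S : alloc n m) (o : option 'I_n) (u : 'I_m) (k : 'I_n) :
  greedy_choice f S u o -> marginal f S k u <= gain S o u.
Proof. by rewrite gainE; case: o => [j [_]|/(_ k)/ltW]; last by []; apply. Qed.

Hypothesis O_disj : pairwise_disjoint O.

Lemma sum_owner_le (u : 'I_m) (c : R) : 0 <= c -> \sum_(j | u \in O j) c <= c.
Proof.
move=> c0; case: (pickP [pred j | u \in O j]) => [j /= uj|no].
  rewrite (big_pred1 j) // => k /=; case: eqVneq => [->|kj]; first by [].
  by apply: contraTF uj => uk; rewrite (disjointFr (O_disj _ _ kj) uk).
by rewrite big_pred0.
Qed.

Hypothesis f_sub : forall j, submodular (f j).

Variables (S : alloc n m) (A : {set 'I_m}) (o : 'I_m -> option 'I_n).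
Hypothesis o_greedy : forall u, greedy_choice f S u (o u).

(** Here [o u] is the greedy decision if [u] comes next. Adding all of [O j :\: A] to [S j] is
    bounded by single marginals, each at most a greedy gain, and disjointness of [O] charges each
    [u] at most once. *)
Lemma greedy_gain_lower :
  residual_welfare S A - welfare f S <= \sum_(u | u \notin A) gain S (o u) u.
Proof.
rewrite /residual_welfare /welfare -sumrB.
apply: (@le_trans _ _ (\sum_(j < n) \sum_(u in O j :\: A) gain S (o u) u)).
  apply: ler_sum => j _.
  apply: le_trans (submodular_le_sum_marginals _ _ _ (f_sub j) _ _) _.
  by apply: ler_sum => u _; exact: marginal_le_gain.
rewrite (exchange_big_dep (fun u => u \notin A)) /=; last first.
  by move=> j u _; rewrite inE => /andP[].
apply: ler_sum => u uA.
apply: le_trans (sum_owner_le u _ (gain_ge0 _ _ _ (o_greedy u))).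
by rewrite le_eqVlt; apply/orP; left; apply/eqP/eq_bigl => j; rewrite inE uA.
Qed.

(** Only two bidders change: the winner of [u] gets [u] on top of her residual set, and the owner of
    [u] in [O] loses it, at a cost of at most the greedy gain. *)
Lemma residual_step (u : 'I_m) : u \notin A ->
  \sum_(k | o u == Some k)
     (f k (u |: (S k :|: (O k :\: A))) - f k (S k :|: (O k :\: A)))
  - gain S (o u) u
  <= residual_welfare (assign S (o u) u) (u |: A) - residual_welfare S A.
Proof.
move=> uA; have g0 := gain_ge0 _ _ _ (o_greedy u).
(* Charging the gain to the owner of [u] reduces the claim to one inequality per bidder. *)
apply: le_trans (lerB (lexx _) (sum_owner_le u _ g0)) _.
rewrite /residual_welfare -sumrB big_mkcond [X in _ - X <= _]big_mkcond -sumrB.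
apply: ler_sum => k _; case: eqP => ok.
  (* The winner holds [u] afterwards, so deleting it from her part of [O] costs nothing. *)
  rewrite ok /= ffunE eqxx.
  have -> : u |: S k :|: O k :\: (u |: A) = u |: (S k :|: O k :\: A).
    by apply/setP => y; rewrite !inE; case: eqP => //= _.
  by case: ifP => _; rewrite ?subr0 // -ok; lra.
have -> : assign S (o u) u k = S k.
  case: (o u) ok => [j jk|] //=; rewrite ffunE; case: eqP => // kj.
  by case: jk; rewrite kj.
case: ifPn => uO; last first.
  have -> : O k :\: (u |: A) = O k :\: A.
    apply/setP => y; rewrite !inE; case: eqP => // ->.
    by rewrite (negPf uO) !andbF.
  by rewrite !subrr.
have -> : O k :\: (u |: A) = (O k :\: A) :\ u.
  by apply/setP => y; rewrite !inE negb_or andbA.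
have uT : u \in O k :\: A by rewrite inE uA.
have := submodular_removal _ _ _ (f_sub k) (S k) _ _ uT.
have := marginal_le_gain _ _ _ k (o_greedy u); rewrite /marginal; lra.
Qed.

Hypothesis f_nonneg : forall j, nonneg_fun (f j).

(** The gain in [welfare] offsets the owner's loss. What remains are the marginals of the items won
    by [k] over [X k]; they sum to at least [f k (X k :|: U) - f k (X k)], hence to at least
    [- f k (X k)]. *)
Lemma greedy_residual_lower :
  - residual_welfare S A <= \sum_(u | u \notin A)
    ((welfare f (assign S (o u) u) + residual_welfare (assign S (o u) u) (u |: A))
     - (welfare f S + residual_welfare S A)).
Proof.
pose X k := S k :|: (O k :\: A).
apply: (@le_trans _ _ (\sum_(u | u \notin A) \sum_(k | o u == Some k)
     (f k (u |: X k) - f k (X k)))); last first.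
  by apply: ler_sum => u uA; have := residual_step _ uA; rewrite /gain -/(X _); lra.
rewrite (exchange_big_dep predT) //= /residual_welfare -sumrN; apply: ler_sum => k _.
pose U := [set u | (u \notin A) && (o u == Some k)]%SET.
have -> : \sum_(u | (u \notin A) && (o u == Some k)) (f k (u |: X k) - f k (X k)) =
          \sum_(u in U) (f k (u |: X k) - f k (X k)).
  by apply: eq_bigl => u; rewrite inE.
apply: le_trans (submodular_le_sum_marginals _ _ _ (f_sub k) _ _).
by rewrite lerDr; exact: f_nonneg.
Qed.

End GreedyStep.

(** * Averages over random prefixes of the arrival order *)

Section PrefixMean.
Variables (R : realType) (m : nat).

Definition arrivals (s : {perm 'I_m}) : seq 'I_m := [seq s k | k <- enum 'I_m].

Lemma size_arrivals (s : {perm 'I_m}) : size (arrivals s) = m.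
Proof. by rewrite size_map size_enum_ord. Qed.

Lemma mem_take_arrivals (s : {perm 'I_m}) (i : nat) (k : 'I_m) :
  (s k \in take i (arrivals s)) = (k < i)%N.
Proof.
rewrite -map_take mem_map; last exact: perm_inj.
by rewrite in_take ?mem_enum // index_enum_ord.
Qed.

Lemma take_arrivalsS (s : {perm 'I_m}) (i : 'I_m) :
  take i.+1 (arrivals s) = rcons (take i (arrivals s)) (s i).
Proof.
rewrite (take_nth (s i)) ?size_arrivals //; congr rcons.
by rewrite (nth_map i) ?size_enum_ord // nth_ord_enum.
Qed.

(* Precomposing with the transposition of [i] and [k >= i] keeps the first [i]
   arrivals, so the next item is uniform among those not yet arrived. *)
Lemma sum_next_arrival (F : seq 'I_m -> 'I_m -> R) (i : 'I_m) :
  \sum_(s : {perm 'I_m}) \sum_(u | u \notin take i (arrivals s)) F (take i (arrivals s)) u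
  = (m - i)%:R * \sum_(s : {perm 'I_m}) F (take i (arrivals s)) (s i).
Proof.
transitivity (\sum_(s : {perm 'I_m}) \sum_(k < m | (i <= k)%N) F (take i (arrivals s)) (s k)).
  apply: eq_bigr => s _; rewrite (reindex_inj (@perm_inj _ s)).
  by apply: eq_bigl => k; rewrite mem_take_arrivals -leqNgt.
rewrite exchange_big /=.
transitivity (\sum_(k < m | (i <= k)%N) \sum_(s : {perm 'I_m}) F (take i (arrivals s)) (s i)).
  apply: eq_bigr => k ik; rewrite (reindex_inj (mulgI (tperm i k))).
  apply: eq_bigr => s _; rewrite permM tpermR; congr (F _ _).
  rewrite -![take i (arrivals _)]map_take; apply/eq_in_map => x.
  rewrite in_take ?mem_enum // index_enum_ord => xi.
  rewrite permM tpermD //; first by rewrite neq_ltn xi orbT.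
  by rewrite neq_ltn (leq_trans xi ik) orbT.
by rewrite -(big_geq_mkord i m predT (fun=> _)) sumr_const_nat mulr_natl.
Qed.

Definition prefix_mean (V : seq 'I_m -> R) (i : nat) : R :=
  (m`!)%:R^-1 * \sum_(s : {perm 'I_m}) V (take i (arrivals s)).

(** The factor [m - i] cancels the probability of each remaining item being next, leaving a plain
    sum over these items. *)
Lemma drift_prefix_mean (V : seq 'I_m -> R) (i : nat) : (i <= m)%N ->
  drift R m (prefix_mean V) i = (m`!)%:R^-1 *
    \sum_(s : {perm 'I_m}) \sum_(u | u \notin take i (arrivals s))
      (V (rcons (take i (arrivals s)) u) - V (take i (arrivals s))).
Proof.
(* At [i = m] there is no next position, and both sides vanish. *)
rewrite leq_eqVlt => /predU1P[->|im].
  rewrite /drift subnn mul0r big1 ?mulr0 // => s _; rewrite big1 // => u.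
  by rewrite -[u](permKV s) mem_take_arrivals ltn_ord.
rewrite (sum_next_arrival (fun l u => V (rcons l u) - V l) (Ordinal im)) /=.
rewrite /drift /prefix_mean -mulrBr -sumrB mulrCA.
congr (_ * (_ * _)); apply: eq_bigr => s _.
by rewrite (take_arrivalsS s (Ordinal im)).
Qed.

Lemma ler_perm_mean (F G : {perm 'I_m} -> R) : (forall s, F s <= G s) ->
  (m`!)%:R^-1 * \sum_(s : {perm 'I_m}) F s <= (m`!)%:R^-1 * \sum_(s : {perm 'I_m}) G s.
Proof. by move=> FG; rewrite ler_wpM2l ?invr_ge0 // ler_sum. Qed.

Lemma prefix_mean0 (V : seq 'I_m -> R) : prefix_mean V 0 = V [::].
Proof.
rewrite /prefix_mean (eq_bigr (fun=> V [::])) => [|s _]; last by rewrite take0.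
by rewrite sumr_const card_Sn -[V [::] *+ _]mulr_natl mulKf // pnatr_eq0 -lt0n fact_gt0.
Qed.

End PrefixMean.

(** * Greedy runs along a sequence, and the final bound *)

Section Run.
Variables (R : realType) (n m : nat) (f : 'I_n -> {set 'I_m} -> R).
Variable sel : seq 'I_m -> alloc n m -> 'I_m -> option 'I_n.

Lemma run_cat (pre : seq 'I_m) (S : alloc n m) (l1 l2 : seq 'I_m) :
  run sel pre S (l1 ++ l2) = run sel (pre ++ l1) (run sel pre S l1) l2.
Proof. by elim: l1 pre S => [|x l1 IH] pre S /=; rewrite ?cats0 // IH cat_rcons. Qed.

Lemma run_rcons (S : alloc n m) (l : seq 'I_m) (u : 'I_m) :
  run sel [::] S (rcons l u) =
  assign (run sel [::] S l) (sel l (run sel [::] S l) u) u.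
Proof. by rewrite -cats1 run_cat. Qed.

Hypothesis sel_greedy : forall pre S i, greedy_choice f S i (sel pre S i).

Lemma welfare_run_ge (pre : seq 'I_m) (S : alloc n m) (l : seq 'I_m) :
  welfare f S <= welfare f (run sel pre S l).
Proof.
elim: l pre S => //= x l IH pre S; apply: le_trans (IH _ _).
by rewrite -subr_ge0; exact: (gain_ge0 _ _ _ f S _ x).
Qed.

End Run.

Theorem theorem3 (R : realType) (n m : nat) (f : 'I_n -> {set 'I_m} -> R)
    (hsub : forall j, submodular (f j)) (hnn : forall j, nonneg_fun (f j))
    (sel : seq 'I_m -> alloc n m -> 'I_m -> option 'I_n)
    (hsel : forall pre S i, greedy_choice f S i (sel pre S i))
    (O : alloc n m) (hO : pairwise_disjoint O) :
  greedy_ratio R * welfare f O <= expected_greedy f sel.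
Proof.
(* Ties may be broken by the whole history, so everything is a function of the list of arrived
   items. *)
pose state := run sel [::] (empty_alloc n m).
pose arrived (l : seq 'I_m) := [set x in l]%SET.
pose V l := welfare f (state l).
pose P l := residual_welfare R n m f O (state l) (arrived l).
have arrivedE l u : arrived (rcons l u) = u |: arrived l.
  by apply/setP => y; rewrite !inE mem_rcons inE.
have notin_arrived l (F : 'I_m -> R) :
    \sum_(u | u \notin l) F u = \sum_(u | u \notin arrived l) F u.
  by apply: eq_bigl => u; rewrite inE.
(* Before any arrival the residual sets are exactly the parts of [O]. *)
have -> : welfare f O = prefix_mean R m P 0.
  rewrite prefix_mean0 /P /residual_welfare; apply: eq_bigr => j _.
  rewrite ffunE; congr (f j _); apply/setP => y.
  by rewrite !inE.
have -> : expected_greedy f sel = prefix_mean R m V m.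
  congr (_ * _); apply: eq_bigr => s _.
  by rewrite /V take_oversize // size_arrivals.
apply: greedy_recurrence.
- by rewrite prefix_mean0 sumr_ge0 // => j _; exact: hnn.
- move=> i im; apply: ler_perm_mean => s.
  (* The full run continues the run on its first [i] items, and greedy steps never lose value. *)
  rewrite [take m _]take_oversize ?size_arrivals // -{2}(cat_take_drop i (arrivals m s)).
  by rewrite /V /state run_cat; exact: welfare_run_ge.
- move=> i im; rewrite drift_prefix_mean // -mulrBr -sumrB.
  apply: ler_perm_mean => s; rewrite notin_arrived.
  rewrite (eq_bigr _ (fun u _ => congr1 (fun T => welfare f T - _) (run_rcons n m sel _ _ u))).
  exact: greedy_gain_lower.
- move=> i im.
  have -> : (fun k => prefix_mean R m V k + prefix_mean R m P k) =
            prefix_mean R m (fun l => V l + P l).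
    by apply/funext => k; rewrite /prefix_mean big_split mulrDr.
  rewrite drift_prefix_mean // -mulrN -sumrN.
  apply: ler_perm_mean => s; rewrite notin_arrived.
  set l := take i _.
  apply: le_trans (greedy_residual_lower R n m f O hO hsub (state l) (arrived l)
    (sel l (state l)) (fun u => hsel l (state l) u) hnn) _.
  by apply: ler_sum => u _; rewrite /V /P /state run_rcons arrivedE.
Qed.
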